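(* Let $\lambda=2^{\alpha_2}3^{\alpha_3}\cdots(N')^{\alpha_{N'}}$ be a partition of a positive integer $n$ having no part equal to $1$, where $\alpha_k\ge0$ is the number of parts equal to $k$ and $N'$ is the largest part, and let $N=\alpha_2+\dots+\alpha_{N'}$ be the number of its parts. Then, as formal power series in $q$, $$R_{\lambda1^\infty}=\frac{1}{(1-q)^{n-N}\,S_{\alpha_2}S_{\alpha_3}\cdots S_{\alpha_{N'}}},$$ where $S_k=(1-q)(1-q^2)\cdots(1-q^k)$ and $S_0=1$.
   Context: A partition of a positive integer $n$ is a sequence $\lambda=(\lambda_1,\dots,\lambda_N)$ of integers with $\lambda_1\ge\dots\ge\lambda_N>0$ and $\lambda_1+\dots+\lambda_N=n$. The symbolic notation $1^{\alpha_1}2^{\alpha_2}3^{\alpha_3}\cdots$ means that $\lambda$ has exactly $\alpha_k$ parts equal to $k$. A strictly upper triangular matrix has Jordan type $\lambda$ if the sizes of its (nilpotent) Jordan blocks, listed in non-increasing order, are $\lambda_1,\dots,\lambda_N$. For a prime power $q$, $P_\lambda(q)$ denotes the number of strictly upper triangular $n\times n$ matrices over the finite field $\mathbb{F}_q$ of Jordan type $\lambda$. It is known that $P_\lambda(q)$ is given by a (nonzero) polynomial in $q$ with integer coefficients, also denoted $P_\lambda$. With $Q=q-1$, write $P_\lambda(q)=q^{d(\lambda)}Q^{e(\lambda)}R_\lambda(q)$, where $R_\lambda$ is a polynomial with $R_\lambda(0)\ne0$ and $R_\lambda(1)\ne0$; this determines the non-negative integers $d(\lambda)$, $e(\lambda)$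 and the polynomial $R_\lambda$ uniquely. For $k\ge0$, let $\lambda1^k$ be the partition of $n+k$ obtained from $\lambda$ by adding $k$ parts equal to $1$. For each fixed $m$, the coefficient of $q^m$ in $R_{\lambda1^k}$ is eventually constant as $k\to\infty$ (because $R_{\lambda1^{k+1}}-R_{\lambda1^k}$ is divisible by $q^{k+1}$ when $\lambda$ has no part equal to $1$); $R_{\lambda1^\infty}$ denotes the formal power series in $q$ whose coefficient of $q^m$ is this eventual value. *)

(* Defs.v *)
From mathcomp Require Import all_boot all_order all_algebra.
From mathcomp Require Import mathcomp_extra boolp classical_sets.

Set Implicit Arguments.
Unset Strict Implicit.
Unset Printing Implicit Defensive.

Import Order.TTheory GRing.Theory Num.Theory.
Local Open Scope ring_scope.

Definition is_partition (n : nat) (lam : seq nat) : bool :=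
  [&& sorted geq lam, 0%N \notin lam & sumn lam == n].

(* The number of parts of lam equal to k is [count_mem k lam]. *)
Definition largest_part (lam : seq nat) : nat := head 0%N lam.

(* Appending ones at the end keeps a partition non-increasing. *)
Definition add_ones (lam : seq nat) (k : nat) : seq nat := lam ++ nseq k 1%N.

Definition part (lam : seq nat) (i : 'I_(size lam)) : nat := nth 0%N lam i.

(* The sum is kept in this form, rather than as [sumn lam], because it is the *)
(* dimension of a block diagonal matrix with block sizes the parts of lam.    *)
Definition psize (lam : seq nat) : nat := (\sum_(i < size lam) part i)%N.

Lemma psizeE (lam : seq nat) : psize lam = sumn lam.
Proof.
by rewrite sumnE (big_nth 0%N) big_mkord.
Qed.

Definition nilpotent_block (F : fieldType) (m : nat) : 'M[F]_m :=
  \matrix_(i, j) (j == i.+1 :> nat)%:R.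

Definition jordan_mx (F : fieldType) (lam : seq nat) : 'M[F]_(psize lam) :=
  \mxdiag_(i < size lam) nilpotent_block F (part i).

Definition strictly_upper (F : fieldType) (n : nat) (A : 'M[F]_n) : bool :=
  [forall i : 'I_n, forall j : 'I_n, (j <= i)%N ==> (A i j == 0)].

Definition has_jordan_type (F : finFieldType) (lam : seq nat)
    (A : 'M[F]_(psize lam)) : bool :=
  [exists U in unitmx, similar U A (jordan_mx F lam)].

Definition P_count (F : finFieldType) (lam : seq nat) : nat :=
  #|[pred A : 'M[F]_(psize lam) | strictly_upper A && has_jordan_type A]|.

Definition counts (lam : seq nat) (p : {poly int}) : Prop :=
  forall F : finFieldType, p.[#|F|%:R] = (P_count F lam)%:R.

Lemma counts_unique (lam : seq nat) (p r : {poly int}) :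
  counts lam p -> counts lam r -> p = r.
Proof.
move=> cp cr; apply/eqP; rewrite -subr_eq0; apply/negPn/negP => pr0.
have [s [us ss ps]] : exists s : seq nat,
    [/\ uniq s, size s = size (p - r) & all prime s].
  elim: (size _) => [|k [s [us ss ps]]]; first by exists [::].
  have [l lgt pl] := prime_above (\max_(x <- s) x).
  exists (l :: s); rewrite /= ss us ps pl; split=> //; rewrite andbT.
  apply/negP => ls; move: lgt; rewrite ltnNge => /negP; apply.
  by rewrite (big_rem l) //= leq_maxl.
have := @max_poly_roots int (p - r) [seq (x%:R : int) | x <- s] pr0.
rewrite size_map ss ltnn map_inj_uniq ?us; last first.
  by move=> x y /eqP; rewrite eqr_nat => /eqP.
suff -> : all (root (p - r)) [seq (x%:R : int) | x <- s] by move=> /(_ isT isT).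
apply/allP => _ /mapP [l ls ->]; have pl := allP ps l ls.
by rewrite /root hornerD hornerN -[X in X%:R](card_Fp pl) cp cr subrr.
Qed.

(* The default value 0 is taken only if no polynomial counts the matrices. *)
Definition P_poly (lam : seq nat) : {poly int} := xget 0 (counts lam).

Definition is_reduced_part (p r : {poly int}) : Prop :=
  exists d e : nat,
    [/\ p = 'X^d * ('X - 1) ^+ e * r, r.[0] != 0 & r.[1] != 0].

Lemma reduced_part_exists (p : {poly int}) :
  p != 0 -> exists r, is_reduced_part p r.
Proof.
move=> p0.
have H (x : int) (s : {poly int}) : s != 0 ->
    exists m t, s = ('X - x%:P) ^+ m * t /\ t.[x] != 0.
  move=> s0; have [m [t [tx ->]]] : exists m t, ~~ root t x /\
      s = t * ('X - x%:P) ^+ m.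
    by have [m [t]] := multiplicity_XsubC s x; rewrite s0 => /= tx ->; exists m, t.
  by exists m, t; rewrite mulrC.
have [d [s [ps s0]]] := H 0 p p0.
have sN0 : s != 0 by apply: contraNneq s0 => ->; rewrite horner0.
have [e [r [sr r1]]] := H 1 s sN0.
exists r, d, e; split => //.
  by rewrite ps sr subr0 mulrA polyC1.
by apply: contraNneq s0 => r0; rewrite sr hornerM r0 mulr0.
Qed.

Lemma reduced_part_unique (p r s : {poly int}) :
  is_reduced_part p r -> is_reduced_part p s -> r = s.
Proof.
have H (a : int) (m m' : nat) (t t' : {poly int}) :
    t.[a] != 0 -> t'.[a] != 0 ->
    ('X - a%:P) ^+ m * t = ('X - a%:P) ^+ m' * t' -> t = t'.
  wlog le_m : m m' t t' / (m <= m')%N.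
    move=> W ta t'a E; have [|/ltnW] := leqP m m' => le_m; first exact: W le_m ta t'a E.
    exact/esym/(W _ _ _ _ le_m t'a ta)/esym.
  move=> ta t'a; rewrite -(subnKC le_m) exprD -mulrA.
  have Xa0 : ('X - a%:P) ^+ m != 0 by rewrite expf_neq0 ?polyXsubC_eq0.
  move=> /(mulfI Xa0) E.
  move: ta E; case: (m' - m)%N => [|k] ta E; first by rewrite E mul1r.
  by move: ta; rewrite E hornerM horner_exp hornerXsubC subrr exprS mul0r mul0r eqxx.
move=> [d [e [-> r0 r1]]] [d' [e' [E s0 s1]]].
apply: (H 1 e e') => //; rewrite polyC1.
have nz0 k : (('X - 1) ^+ k : {poly int}).[0] != 0.
  by rewrite horner_exp expf_neq0// hornerD hornerX hornerN hornerC sub0r oppr_eq0 oner_eq0.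
apply: (H 0 d d'); rewrite ?hornerM ?mulf_neq0//.
by rewrite subr0 !mulrA.
Qed.

Definition R_poly (lam : seq nat) : {poly int} :=
  xget 0 (is_reduced_part (P_poly lam)).

(* Formal power series over int are represented by their coefficients. *)
Definition series : Type := nat -> int.

Definition is_R_infty (lam : seq nat) (s : series) : Prop :=
  forall m : nat, exists K : nat, forall k : nat, (K <= k)%N ->
    (R_poly (add_ones lam k))`_m = s m.

(* For D with constant coefficient 1, 1 / D is the sum of the powers (1-D)^j; *)
(* only those with j <= m contribute to the coefficient of degree m.          *)
Definition series_inv (D : {poly int}) : series :=
  fun m => (\sum_(j < m.+1) (1 - D) ^+ j)`_m.

Lemma series_invP (D : {poly int}) : D`_0 = 1 ->
  forall m, \sum_(i < m.+1) D`_i * series_inv D (m - i)%N = (m == 0%N)%:R.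
Proof.
move=> D0 m; pose u := 1 - D.
have uX : exists v, u = v * 'X.
  have : root u 0 by rewrite /root horner_coef0 coefB coef1 D0 subrr.
  by move=> /factor_theorem [v ->]; exists v; rewrite subr0.
have uj j i : (i < j)%N -> (u ^+ j)`_i = 0.
  by case: uX => v -> ij; rewrite exprMn coefMXn ij.
have invE a : (a <= m)%N -> series_inv D a = (\sum_(j < m.+1) u ^+ j)`_a.
  move=> am; rewrite /series_inv -/u !coef_sum.
  rewrite (big_ord_widen m.+1 (fun j => (u ^+ j)`_a)) ?ltnS//.
  rewrite [RHS](bigID (fun j : 'I_m.+1 => (j < a.+1)%N)) /=.
  rewrite [X in _ + X]big1 ?addr0// => j; rewrite -leqNgt => aj.
  exact: uj.
transitivity ((D * \sum_(j < m.+1) u ^+ j)`_m).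
  by rewrite coefM; apply: eq_bigr => i _; rewrite invE ?leq_subr.
have -> : D = 1 - u by rewrite /u opprB addrC subrK.
by rewrite -opprB mulNr -subrX1 opprB coefB coef1 uj// subr0.
Qed.

Definition S_poly (k : nat) : {poly int} := \prod_(1 <= i < k.+1) (1 - 'X^i).

(* Main.v *)
Require Import Defs.
From mathcomp Require Import all_boot all_order all_algebra.
From mathcomp Require Import mathcomp_extra boolp classical_sets.
From mathcomp Require Import mxabelem zify ring.

Set Implicit Arguments.
Unset Strict Implicit.
Unset Printing Implicit Defensive.

Import Order.TTheory GRing.Theory Num.Theory.
Local Open Scope ring_scope.

(** A strictly upper triangular matrix is encoded by the drops
    c_i = rank A^i - rank A^(i+1).  They are the columns of the diagram of its
    Jordan type and determine that type, because a longest Jordan chain of a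
    nilpotent matrix always splits off ([split_longest_chain]).

    Write A as a first row v on top of a smaller matrix B, of size n and with
    drops c.  The drops of A are c with one box added, in column j say, and the
    number of v that add it there is q^(n-c_j) - q^(n-c_(j-1)), the second term
    being absent for j = 0.  This yields a recurrence for P over the corners of the diagram
    ([drop_count_rec]).  The power of q-1 gained along a path of the recurrence
    is the number of boxes outside the first column.  The power of q depends on the
    path only through the pairs of boxes in adjacent columns that are added in
    the wrong order: exactly one path, column after column, has no such pair.
    Dividing both powers out leaves the recurrence
      R_c = sum over the corners j of q^(c_(j+1)) [c_(j-1) - c_j + 1] R_(c - box j),
    where the q-number is replaced by 1 when j = 0 ([R_rec]); uniqueness of the
    good path shows R(0) = 1, and positivity shows R(1) > 0, so this is the
    polynomial R of the partition ([R_polyE]).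

    Let D_c be the denominator of the claimed limit.  Removing a box changes
    D_c by a simple factor which, combined with the q-number, turns the j-th
    term of the recurrence for D_c R_c into q^(c_(j+1)) - q^(c_j) times D R of
    the smaller diagram, up to a factor 1 - q^(k+1) for j = 1 when there are k
    parts equal to 1, while the term j = 0 gets q^(c_1).  If all smaller
    products D R are congruent to 1, the sum telescopes to 1.  Keeping track of
    precision, D R is congruent to 1 modulo q^(k+1) ([R_denom_mul_R_rec]), which gives the coefficients of R up to q^k. *)

(** * Jordan types and ranks of powers *)

Section JordanType.
Variable F : fieldType.

(** For a nilpotent matrix, the number of Jordan blocks of size larger than i. *)
Definition rank_drop n (A : 'M[F]_n) (i : nat) : nat :=
  (\rank (A ^+ i) - \rank (A ^+ i.+1))%N.

Lemma rank_exp_anti n (A : 'M[F]_n) i j :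
  (i <= j)%N -> (\rank (A ^+ j) <= \rank (A ^+ i))%N.
Proof. by move=> /subnK <-; rewrite exprD -mulmxE mxrankM_maxr. Qed.

Lemma rank_dropD n (A : 'M[F]_n) i :
  (\rank (A ^+ i) = \rank (A ^+ i.+1) + rank_drop A i)%N.
Proof. by rewrite subnKC // rank_exp_anti. Qed.

(** Frobenius' rank inequality, applied to A, A^i and A. *)
Lemma rank_drop_anti n (A : 'M[F]_n) i : (rank_drop A i.+1 <= rank_drop A i)%N.
Proof.
have := mxrank_Frobenius A (A ^+ i) A.
rewrite !mulmxE -exprS -!exprSr.
rewrite (rank_dropD A i) (rank_dropD A i.+1); lia.
Qed.

(** Similarity of square matrices whose sizes are not known to coincide
    syntactically; the sizes are then equal, but no cast is needed. *)
Definition sim m n (A : 'M[F]_m) (B : 'M[F]_n) :=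
  exists U : 'M_(m, n), exists V : 'M_(n, m),
    [/\ U *m V = 1%:M, V *m U = 1%:M & U *m B = A *m U].

Lemma sim_trans m n p (A : 'M_m) (B : 'M_n) (C : 'M_p) :
  sim A B -> sim B C -> sim A C.
Proof.
move=> [U [V [UV VU UB]]] [X [Y [XY YX XC]]].
exists (U *m X), (Y *m V); split.
- by rewrite mulmxA -(mulmxA U) XY mulmx1.
- by rewrite mulmxA -(mulmxA Y) VU mulmx1.
- by rewrite -mulmxA XC !mulmxA UB.
Qed.

Lemma sim_sym m n (A : 'M_m) (B : 'M_n) : sim A B -> sim B A.
Proof.
move=> [U [V [UV VU UB]]]; exists V, U; split=> //.
by rewrite -[LHS]mulmx1 -UV !mulmxA -(mulmxA V) -UB mulmxA VU mul1mx.
Qed.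

Lemma sim_rank_exp m n (A : 'M_m) (B : 'M_n) i :
  sim A B -> \rank (A ^+ i) = \rank (B ^+ i).
Proof.
have le m' n' (A' : 'M_m') (B' : 'M_n') :
    sim A' B' -> (\rank (A' ^+ i) <= \rank (B' ^+ i))%N.
  move=> [U [V [UV VU UB]]].
  have UBi : U *m B' ^+ i = A' ^+ i *m U.
    elim: i => [|i IH]; first by rewrite !expr0 mul1mx mulmx1.
    by rewrite !exprSr -!mulmxE mulmxA IH -!mulmxA UB.
  rewrite -[A' ^+ i]mulmx1 -UV mulmxA -UBi -mulmxA.
  by apply: leq_trans (mxrankM_maxr _ _) _; apply: mxrankM_maxl.
by move=> AB; apply/eqP; rewrite eqn_leq !le//; apply: sim_sym.
Qed.

Lemma sim_block m n p (J : 'M_p) (A : 'M_m) (B : 'M_n) :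
  sim A B -> sim (block_mx J 0 0 A) (block_mx J 0 0 B).
Proof.
move=> [U [V [UV VU UB]]].
exists (block_mx 1%:M 0 0 U), (block_mx 1%:M 0 0 V).
rewrite !mulmx_block ?mulmx0 ?mul0mx ?addr0 ?add0r ?mulmx1 ?mul1mx.
by rewrite UV VU UB -!scalar_mx_block.
Qed.

Lemma exp_diag_block m n (A : 'M[F]_m) (B : 'M[F]_n) i :
  block_mx A 0 0 B ^+ i = block_mx (A ^+ i) 0 0 (B ^+ i).
Proof.
elim: i => [|i IH]; first by rewrite !expr0 -scalar_mx_block.
by rewrite !exprS IH -!mulmxE mulmx_block !mulmx0 !mul0mx !addr0 !add0r.
Qed.

Lemma rank_drop_diag_block m n (A : 'M[F]_m) (B : 'M[F]_n) i :
  rank_drop (block_mx A 0 0 B) i = (rank_drop A i + rank_drop B i)%N.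
Proof.
rewrite /rank_drop !exp_diag_block !rank_diag_block_mx.
by rewrite (rank_dropD A i) (rank_dropD B i); lia.
Qed.

Lemma mul_nilpotent_block m n (f : nat -> 'rV[F]_n) :
  nilpotent_block F m *m (\matrix_(i < m) f i) =
  \matrix_(i < m) (if (i.+1 < m)%N then f i.+1 else 0).
Proof.
apply/matrixP=> i j; rewrite !mxE; case: ltnP => im.
  rewrite (bigD1 (Ordinal im)) //= !mxE eqxx mul1r big1 ?addr0 // => k.
  by rewrite -val_eqE /= => /negbTE ik; rewrite !mxE ik mul0r.
rewrite mxE big1 // => k _; rewrite !mxE.
by rewrite ltn_eqF ?mul0r//; apply: leq_trans im.
Qed.

Lemma mulmx_nilpotent_block m n (f : nat -> 'cV[F]_n) :
  (\matrix_(i < n, j < m) f j i 0) *m nilpotent_block F m =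
  \matrix_(i < n, j < m) (if val j is j'.+1 then f j' else 0) i 0.
Proof.
apply/matrixP=> i [[|j] jm]; rewrite !mxE /=.
  by rewrite ?mxE big1 // => k _; rewrite !mxE mulr0.
rewrite (bigD1 (Ordinal (ltnW jm))) //= !mxE eqxx mulr1 big1 ?addr0 // => k.
by rewrite -val_eqE /= !mxE eqSS eq_sym => /negbTE ->; rewrite mulr0.
Qed.

Lemma nilpotent_block_exp0 m : nilpotent_block F m ^+ m = 0.
Proof.
pose e (l : nat) : 'rV[F]_m := \row_(j < m) (j == l :> nat)%:R.
have e0 l : (m <= l)%N -> e l = 0.
  move=> ml; apply/rowP=> j; rewrite !mxE ltn_eqF //.
  exact: leq_trans (ltn_ord j) ml.
have E i : nilpotent_block F m ^+ i = \matrix_(k < m) e (k + i)%N.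
  elim: i => [|i IH].
    by apply/matrixP=> k l; rewrite !mxE addn0 eq_sym.
  rewrite exprS -mulmxE IH (mul_nilpotent_block m (fun k => e (k + i)%N)).
  apply/row_matrixP=> k; rewrite !rowK addSnnS; case: ltnP => // mk.
  by rewrite e0 // -addSnnS (leq_trans mk) ?leq_addr.
by rewrite E; apply/row_matrixP=> k; rewrite rowK row0 e0 // leq_addl.
Qed.

Lemma rank_nilpotent_block m : (m.-1 <= \rank (nilpotent_block F m))%N.
Proof.
case: m => // m /=.
have rkJ : \rank (mxsub (lift ord_max) (lift ord0) (nilpotent_block F m.+1)) = m.
  rewrite -[RHS](mxrank1 F); congr (\rank _); apply/matrixP => i j.
  by rewrite !mxE lift0 lift_max eqSS eq_sym -val_eqE.
rewrite -{1}rkJ -[X in mxsub _ _ X]mulmx1 mxsub_mul.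
by apply: leq_trans (mxrankM_maxl _ _) _; apply: mxrankS; apply: rowsub_sub.
Qed.

(** Each multiplication by a Jordan block lowers the rank by at most one, and
    its m-th power vanishes, so that the m drops must all be equal to one. *)
Lemma rank_drop_nilpotent_block m i : rank_drop (nilpotent_block F m) i = (i < m)%N.
Proof.
set J := nilpotent_block F m.
have step k : (rank_drop J k <= 1)%N.
  have := mxrank_mul_min (J ^+ k) J; rewrite mulmxE -exprSr.
  have := rank_nilpotent_block m; have := rank_leq_row (J ^+ k).
  by rewrite -/J /rank_drop; lia.
have steps k j : (\rank (J ^+ k) <= \rank (J ^+ (k + j)) + j)%N.
  elim: j => [|j IH]; first by rewrite !addn0.
  by rewrite !addnS; have := rank_dropD J (k + j); have := step (k + j)%N; lia.
have rankJ k : \rank (J ^+ k) = (m - k)%N.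
  have J0 l : (m <= l)%N -> \rank (J ^+ l) = 0%N.
    by move=> /subnK <-; rewrite exprD nilpotent_block_exp0 mulr0 mxrank0.
  have := steps 0%N k; rewrite expr0 mxrank1 add0n.
  have [km|/ltnW/J0 ->] := leqP k m; last by lia.
  by have := steps k (m - k)%N; rewrite subnKC // (J0 m) //; lia.
by rewrite /rank_drop !rankJ; case: ltnP; lia.
Qed.


(** A chain v, v A, ..., v A^m of maximal length spans a copy of a Jordan
    block.  A functional phi with v A^m phi = 1 provides a stable complement,
    the common kernel of phi, A phi, ..., A^m phi: the matrix of the pairings
    of the two chains is unitriangular. *)
Lemma split_longest_chain n (A : 'M[F]_n) m (v : 'rV_n) (phi : 'cV_n) :
    A ^+ m.+1 = 0 -> v *m A ^+ m *m phi = 1%:M ->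
  exists p, exists A' : 'M_p, sim A (block_mx (nilpotent_block F m.+1) 0 0 A').
Proof.
move=> Am0 vphi; set J := nilpotent_block F m.+1.
pose f i := v *m A ^+ i.
pose g j := A ^+ (m - j) *m phi.
pose V : 'M_(m.+1, n) := \matrix_(i < m.+1) f i.
pose W : 'M_(n, m.+1) := \matrix_(i < n, j < m.+1) g j i 0.
have VA : V *m A = J *m V.
  rewrite mul_nilpotent_block; apply/row_matrixP=> i.
  rewrite row_mul !rowK /f -mulmxA mulmxE -exprSr ltnS.
  case: ltnP => // mi; have -> : i = m :> nat by have := ltn_ord i; lia.
  by rewrite Am0 mulmx0.
have AW : A *m W = W *m J.
  rewrite (mulmx_nilpotent_block m.+1 g).
  apply/matrixP=> i j; rewrite [RHS]mxE.
  have -> : (A *m W) i j = (A *m g j) i 0.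
    by rewrite !mxE; apply: eq_bigr => k _; rewrite mxE.
  rewrite /g mulmxA mulmxE -exprS; case: j => [[|j] jm] /=.
    by rewrite subn0 Am0 mul0mx.
  by have -> : (m - j.+1).+1 = (m - j)%N by lia.
pose T := V *m W.
have TE i j : T i j = (v *m A ^+ (i + (m - j)) *m phi) 0 0.
  rewrite exprD -mulmxE mulmxA -mulmxA !mxE.
  by apply: eq_bigr => k _; rewrite !mxE.
(* T is upper unitriangular, because A^(m+1) = 0. *)
have Tu : T \in unitmx.
  rewrite unitmxE -det_tr det_trig; last first.
    apply/is_trig_mxP=> i j ij; rewrite mxE TE.
    have -> : (j + (m - i) = m.+1 + (j - i.+1))%N by have := ltn_ord i; lia.
    by rewrite exprD Am0 mul0r mulmx0 mul0mx mxE.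
  rewrite big1 ?unitr1 // => i _; rewrite mxE TE.
  have -> : (i + (m - i) = m)%N by rewrite subnKC // -ltnS.
  by rewrite vphi mxE.
pose p := \rank (kermx W); pose K : 'M_(p, n) := row_base (kermx W).
have Kfree : row_free K by apply: row_base_free.
have subK q (X : 'M_(q, n)) : X *m W = 0 -> exists Y, X = Y *m K.
  by move=> /sub_kermxP XK; apply/submxP; rewrite eq_row_base.
have KW : K *m W = 0 by apply/sub_kermxP; rewrite eq_row_base.
(* Z V projects onto the chain along the kernel of W, which K spans. *)
pose Z := W *m invmx T.
have VZ : V *m Z = 1%:M by rewrite mulmxA mulmxV.
have KZ : K *m Z = 0 by rewrite mulmxA KW mul0mx.
have [Y YK] : exists Y, 1%:M - Z *m V = Y *m K.
  by apply: subK; rewrite mulmxBl mul1mx -!mulmxA mulVmx // mulmx1 subrr.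
have [A' A'K] : exists A', K *m A = A' *m K.
  by apply: subK; rewrite -mulmxA AW mulmxA KW mul0mx.
have VY : V *m Y = 0.
  apply: (row_free_inj Kfree); rewrite -mulmxA -YK mulmxBr mulmx1 mulmxA VZ.
  by rewrite mul1mx subrr mul0mx.
have KY : K *m Y = 1%:M.
  apply: (row_free_inj Kfree); rewrite -mulmxA -YK mulmxBr mulmx1 mulmxA KZ.
  by rewrite !mul0mx subr0 mul1mx.
exists p, A'; apply: sim_sym; exists (col_mx V K), (row_mx Z Y); split.
- by rewrite mul_col_row VZ VY KZ KY -scalar_mx_block.
- by rewrite mul_row_col -YK addrC subrK.
- by rewrite mul_col_mx mul_block_col !mul0mx addr0 add0r VA A'K.
Qed.

Lemma sim_castmx m n (e : m = n) (A : 'M[F]_m) : sim A (castmx (e, e) A).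
Proof.
case: _ / e; rewrite castmx_id; exists 1%:M, 1%:M.
by rewrite !mulmx1 mul1mx.
Qed.

Lemma jordan_mx_cons m lam :
  sim (jordan_mx F (m :: lam)) (block_mx (nilpotent_block F m) 0 0 (jordan_mx F lam)).
Proof.
apply: sim_sym; rewrite /jordan_mx mxdiag_recl /=.
exact: sim_castmx.
Qed.

(** The columns of the diagram of lam, numbered from 0. *)
Definition conj_part (lam : seq nat) (i : nat) : nat := count (ltn i) lam.

Lemma sim_rank_drop m n (A : 'M_m) (B : 'M_n) i :
  sim A B -> rank_drop A i = rank_drop B i.
Proof. by move=> AB; rewrite /rank_drop !(sim_rank_exp _ AB). Qed.

Lemma rank_drop_jordan_mx lam i : rank_drop (jordan_mx F lam) i = conj_part lam i.
Proof.
elim: lam => [|m lam IH].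
  have r0 (A : 'M[F]_(psize [::])) : \rank A = 0%N.
    by apply/eqP; rewrite -leqn0 (leq_trans (rank_leq_row _)) // psizeE.
  by rewrite /rank_drop !r0.
rewrite (sim_rank_drop _ (jordan_mx_cons m lam)) rank_drop_diag_block.
by rewrite rank_drop_nilpotent_block IH.
Qed.

(** By induction on the partition: the ranks of the powers force A to have a
    longest chain of length the largest part, and the complement of that chain
    has the drops of the remaining partition. *)
Lemma nilpotent_sim_jordan_mx lam n (A : 'M[F]_n) N :
    sorted geq lam -> 0%N \notin lam -> A ^+ N = 0 ->
    (forall i, rank_drop A i = conj_part lam i) ->
  sim A (jordan_mx F lam).
Proof.
elim: lam n A => [|m lam IH] n A lam_sorted lam0 AN dropA.
  have rA k : \rank (A ^+ k) = \rank (A ^+ 0).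
    by elim: k => // k <-; rewrite (rank_dropD A k) dropA addn0.
  have n0 : n = 0%N by have := rA N; rewrite AN mxrank0 expr0 mxrank1.
  have p0 : psize [::] = 0%N by rewrite psizeE.
  exists 0, 0; split; apply/matrixP => -[i im] j; exfalso; move: im.
  - by rewrite n0.
  - by rewrite p0.
  - by rewrite n0.
move: lam0; rewrite inE negb_or eq_sym -lt0n => /andP [m_gt0 lam0].
case: m m_gt0 lam_sorted dropA => // m _ lam_sorted dropA.
have lam_le : all (geq m.+1) lam.
  by apply: order_path_min lam_sorted => x y z /= yx zy; apply: leq_trans zy yx.
have Am0 : A ^+ m.+1 = 0.
  apply/eqP; rewrite -mxrank_eq0.
  have rA k : \rank (A ^+ (m.+1 + k)) = \rank (A ^+ m.+1).
    elim: k => [|k <-]; first by rewrite addn0.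
    rewrite addnS (rank_dropD A (m.+1 + k)) dropA.
    suff -> : conj_part (m.+1 :: lam) (m.+1 + k) = 0%N by rewrite addn0.
    rewrite /conj_part /= ltnNge leq_addr add0n; apply/eqP.
    rewrite eqn0Ngt -has_count -all_predC; apply: sub_all lam_le => x /= xm.
    by rewrite -leqNgt (leq_trans xm) ?leq_addr.
  by rewrite -(rA N) exprD AN mulr0 mxrank0.
have [i [j Aij]] : exists i j, (A ^+ m) i j != 0.
  have : A ^+ m != 0.
    by rewrite -mxrank_eq0 rank_dropD Am0 mxrank0 dropA /conj_part /= ltnSn.
  apply: contraNP => A0; apply/eqP/matrixP=> i j; rewrite mxE; apply/eqP.
  by apply: contra_notT A0 => Aij; exists i, j.
have [p [A' AA']] : exists p, exists A' : 'M_p,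
    sim A (block_mx (nilpotent_block F m.+1) 0 0 A').
  apply: (@split_longest_chain _ A m (delta_mx 0 i)
            (((A ^+ m) i j)^-1 *: delta_mx j 0)) => //.
  rewrite -scalemxAr -rowE -colE; apply/matrixP=> k l.
  by rewrite !ord1 !mxE mulVf.
apply: (sim_trans AA'); apply: (sim_trans _ (sim_sym (jordan_mx_cons _ _))).
apply/sim_block/IH => //.
- exact: path_sorted lam_sorted.
- have := sim_rank_exp N AA'; rewrite AN mxrank0 exp_diag_block rank_diag_block_mx.
  by move=> /esym/eqP; rewrite addn_eq0 => /andP [_]; rewrite mxrank_eq0 => /eqP.
- move=> k; have := dropA k; rewrite (sim_rank_drop _ AA') rank_drop_diag_block.
  by rewrite rank_drop_nilpotent_block => /addnI.
Qed.

End JordanType.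

(** * Extending a matrix by a row *)

Section Counting.
Variable F : finFieldType.

Lemma strictly_upperP n (A : 'M[F]_n) :
  reflect (forall i j : 'I_n, (j <= i)%N -> A i j = 0) (strictly_upper A).
Proof.
apply: (iffP forallP) => [A0 i j ji|A0 i].
  by apply/eqP; have /forallP/(_ j)/implyP := A0 i; apply.
by apply/forallP=> j; apply/implyP=> ji; apply/eqP/A0.
Qed.

Lemma strictly_upper_nilpotent n (A : 'M[F]_n) : strictly_upper A -> A ^+ n = 0.
Proof.
move=> /strictly_upperP A0.
have Ak k (i j : 'I_n) : (j < i + k)%N -> (A ^+ k) i j = 0.
  elim: k i j => [|k IH] i j.
    by rewrite addn0 expr0 mxE => ji; rewrite -val_eqE gtn_eqF.
  rewrite addnS ltnS => ji; rewrite exprS -mulmxE mxE big1 // => l _.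
  have [li|il] := leqP l i; first by rewrite A0 // mul0r.
  by rewrite IH ?mulr0 // (leq_ltn_trans ji) // ltn_add2r.
apply/matrixP=> i j; rewrite mxE; apply: Ak.
exact: leq_trans (ltn_ord j) (leq_addl _ _).
Qed.

Definition drop_count n (c : nat -> nat) : nat :=
  #|[pred A : 'M[F]_n | strictly_upper A && `[< rank_drop A = c >]]|.

Lemma P_countE lam : sorted geq lam -> 0%N \notin lam ->
  P_count F lam = drop_count (psize lam) (conj_part lam).
Proof.
move=> lam_sorted lam0; apply: eq_card => A; rewrite !inE /=.
case suA: strictly_upper => //=; apply/idP/asboolP => [|dropA].
  move=> /existsP [U /andP [Uu /(similarP Uu) UA]].
  apply/funext=> i; rewrite -(rank_drop_jordan_mx F); apply: sim_rank_drop.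
  by apply: sim_sym; exists U, (invmx U); rewrite mulmxV ?mulVmx.
have [|U [V [UV VU UJ]]] := nilpotent_sim_jordan_mx lam_sorted lam0
  (strictly_upper_nilpotent suA); first by move=> i; rewrite dropA.
have [_ Vu] := mulmx1_unit UV.
apply/existsP; exists V; apply/andP; split => //; apply/(similarP Vu).
by rewrite -[V *m A]mulmx1 -UV mulmxA -(mulmxA V A) -UJ !mulmxA VU mul1mx.
Qed.

Definition extend_mx n (v : 'rV[F]_n) (B : 'M[F]_n) : 'M[F]_(1 + n) :=
  block_mx 0 v 0 B.

Lemma strictly_upper_extend n (v : 'rV_n) (B : 'M_n) :
  strictly_upper (extend_mx v B) = strictly_upper B.
Proof.
apply/strictly_upperP/strictly_upperP => [A0 i j ji|B0 i j].
  by have := A0 (rshift 1 i) (rshift 1 j); rewrite block_mxEdr; apply.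
rewrite -[i]splitK -[j]splitK; case: (split i) (split j) => [i'|i'] [j'|j'] /= ji.
- by rewrite block_mxEul mxE.
- by move: ji; rewrite ord1.
- by rewrite block_mxEdl mxE.
- by rewrite block_mxEdr B0.
Qed.

Lemma strictly_upper_extendP n (A : 'M[F]_(1 + n)) : strictly_upper A ->
  A = extend_mx (ursubmx A) (drsubmx A).
Proof.
move=> /strictly_upperP A0; rewrite -[LHS]submxK; congr block_mx.
- by apply/matrixP=> i j; rewrite !mxE A0 // !ord1.
- by apply/matrixP=> i j; rewrite !mxE A0 // !ord1.
Qed.

Lemma extend_mx_exp n (v : 'rV_n) (B : 'M_n) i :
  extend_mx v B ^+ i.+1 = block_mx 0 (v *m B ^+ i) 0 (B ^+ i.+1).
Proof.
elim: i => [|i IH]; first by rewrite !expr1 expr0 mulmx1.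
rewrite exprSr IH -mulmxE mulmx_block !mulmx0 !mul0mx !add0r.
by rewrite -mulmxA !mulmxE -!exprSr.
Qed.

(** Whether the i-th power of the extension of B by v has larger rank than the
    i-th power of B. *)
Definition rank_grows n (v : 'rV[F]_n) (B : 'M[F]_n) (i : nat) : bool :=
  if i is i'.+1 then ~~ (v *m B ^+ i' <= B ^+ i)%MS else true.

Lemma rank_extend_exp n (v : 'rV_n) (B : 'M_n) i :
  \rank (extend_mx v B ^+ i) = (\rank (B ^+ i) + rank_grows v B i)%N.
Proof.
case: i => [|i]; first by rewrite !expr0 !mxrank1 addnC.
rewrite extend_mx_exp block_mxEh col_mx0 rank_row_0mx -addsmxE /=.
set a := v *m _; set b := B ^+ _.
case: (boolP (a <= b)%MS) => [/addsmx_idPr ->|ab]; first by rewrite addn0.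
apply/eqP; rewrite addn1 eqn_leq; apply/andP; split.
  apply: leq_trans (mxrank_adds_leqif _ _) _.
  by rewrite -[leqRHS]add1n leq_add2r rank_leq_row.
rewrite (ltn_leqif (mxrank_leqif_sup (addsmxSr a b))).
by rewrite addsmx_sub (negbTE ab).
Qed.

Lemma rank_grows_anti n (v : 'rV_n) (B : 'M_n) i :
  rank_grows v B i.+1 -> rank_grows v B i.
Proof.
case: i => //= i; apply: contraNN => /(submxMr B).
by rewrite -mulmxA !mulmxE -!exprSr.
Qed.

Lemma rank_grows_le n (v : 'rV_n) (B : 'M_n) i j : (i <= j)%N ->
  rank_grows v B j -> rank_grows v B i.
Proof.
move=> /subnK <-; elim: (j - i)%N => [|k IH] //.
by rewrite addSn => /rank_grows_anti.
Qed.

(** The rank grows for the powers up to j and not beyond, so that exactly the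
    j-th drop increases. *)
Definition adds_box_at n (v : 'rV[F]_n) (B : 'M[F]_n) (j : nat) : bool :=
  rank_grows v B j && ~~ rank_grows v B j.+1.

Lemma adds_box_at_ex n (v : 'rV_n) (B : 'M_n) : strictly_upper B ->
  exists j, forall i, adds_box_at v B i = (i == j).
Proof.
(* B^n = 0, so that the rank of the (n+1)-st power does not grow. *)
move=> /strictly_upper_nilpotent Bn.
have exg : exists i, rank_grows v B i by exists 0%N.
have bg i : rank_grows v B i -> (i <= n)%N.
  rewrite leqNgt => g; apply/negP => /rank_grows_le /(_ g) /=.
  by rewrite Bn mulmx0 sub0mx.
have [j gj jmax] := ex_maxnP exg bg.
exists j => i; apply/idP/eqP => [/andP [gi gSi]|->].
  apply/eqP; rewrite eqn_leq jmax //= leqNgt; apply: contra gSi => ij.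
  exact: rank_grows_le ij gj.
by rewrite /adds_box_at gj; apply/negP => /jmax; rewrite ltnn.
Qed.

Lemma rank_drop_extend n (v : 'rV_n) (B : 'M_n) i :
  rank_drop (extend_mx v B) i = (rank_drop B i + adds_box_at v B i)%N.
Proof.
rewrite /rank_drop /adds_box_at !rank_extend_exp (rank_dropD B i).
have := @rank_grows_anti _ v B i.
move: (\rank (B ^+ i.+1)) (rank_drop B i) => r d.
case: (rank_grows v B i) => [_|/contraFF ->] //=; last by lia.
by case: (rank_grows v B i.+1) => /=; lia.
Qed.

(** The vectors v with v B^i in the row space of B^(i+1) form the sum of the
    row space of B and the kernel of B^i. *)
Lemma card_rank_not_grows n (B : 'M[F]_n) i :
  #|[pred v | ~~ rank_grows v B i.+1]| = (#|F| ^ (n - rank_drop B i))%N.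
Proof.
have -> : #|[pred v | ~~ rank_grows v B i.+1]| = #|rowg (B + kermx (B ^+ i))%MS|.
  apply: eq_card => v; rewrite !inE /= negbK; apply/idP/idP.
    move=> /submxP [D]; rewrite exprS -mulmxE mulmxA => vD.
    rewrite -[v](subrK (D *m B)) addrC addmx_sub_adds ?submxMl //.
    by apply/sub_kermxP; rewrite mulmxBl vD subrr.
  move=> /(submxMr (B ^+ i)); rewrite addsmxMr mulmx_ker addsmx0.
  by rewrite mulmxE -exprS.
rewrite card_rowg; congr (_ ^ _)%N.
have := mxrank_sum_cap B (kermx (B ^+ i)); have := mxrank_mul_ker B (B ^+ i).
rewrite mulmxE -exprS mxrank_ker; have := rank_dropD B i.
have := rank_leq_row (B ^+ i).
move: (\rank (B ^+ i)) (\rank (B ^+ i.+1)) (rank_drop B i) => r r' d.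
move: (\rank (B + _)) (\rank (B :&: _)) (\rank B) => x y z; lia.
Qed.

(** The number of rows v adding a box in column j to a matrix with drops c. *)
Definition box_weight (q : int) (n : nat) (c : nat -> nat) (j : nat) : int :=
  q ^+ (n - c j) - (if j is j'.+1 then q ^+ (n - c j') else 0).

Lemma card_adds_box_at n (B : 'M[F]_n) j :
  #|[pred v | adds_box_at v B j]|%:R = box_weight #|F|%:R n (rank_drop B) j.
Proof.
rewrite /box_weight -natrX -card_rank_not_grows.
case: j => [|j]; first by rewrite subr0; congr _%:R; apply: eq_card => v.
apply/eqP; rewrite eq_sym subr_eq -natrX -card_rank_not_grows -natrD; apply/eqP.
congr _%:R; rewrite -cardUI [X in (_ + X)%N]eq_card0 ?addn0; last first.
  by move=> v; rewrite !inE /adds_box_at andbAC andbN.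
apply: eq_card => v; rewrite !inE /adds_box_at.
have := @rank_grows_anti _ v B j.+1.
by case: (rank_grows v B j.+1); case: (rank_grows v B j.+2) => // /(_ isT).
Qed.

End Counting.

(** * The recurrence for the number of matrices *)

Definition remove_box (c : nat -> nat) (j : nat) : nat -> nat :=
  fun i => (c i - (i == j))%N.

Section Recurrence.
Variable F : finFieldType.

Lemma adds_box_atE n (v : 'rV[F]_n) (B : 'M[F]_n) c L :
    strictly_upper B -> (forall i, (L <= i)%N -> c i = 0%N) ->
  (`[< rank_drop (extend_mx v B) = c >] =
   \sum_(j < L | (0 < c j)%N)
     `[< rank_drop B = remove_box c j >] && adds_box_at v B j :> nat)%N.
Proof.
move=> suB c0; have [k atE] := adds_box_at_ex v suB.
have dropE i : rank_drop (extend_mx v B) i = (rank_drop B i + (i == k))%N.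
  by rewrite rank_drop_extend atE.
have main : `[< rank_drop (extend_mx v B) = c >] =
    (0 < c k)%N && `[< rank_drop B = remove_box c k >].
  apply/asboolP/andP => [<-|[ck /asboolP dropB]].
    split; first by rewrite dropE eqxx addn1.
    by apply/asboolP/funext=> i; rewrite /remove_box dropE addnK.
  apply/funext=> i; rewrite dropE dropB /remove_box subnK //.
  by case: eqP => // ->.
have [kL|Lk] := ltnP k L.
  rewrite big_mkcond (bigD1 (Ordinal kL)) //= main atE eqxx andbT.
  rewrite big1 ?addn0; first by case: ifP.
  move=> j; rewrite -val_eqE /= => /negbTE jk.
  by rewrite atE jk andbF; case: ifP.
rewrite main c0 //= big1 // => j _; rewrite atE ltn_eqF ?andbF //.
exact: leq_trans (ltn_ord j) Lk.
Qed.

Lemma drop_countE n c : drop_count F n c =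
  (\sum_(A : 'M[F]_n | strictly_upper A) `[< rank_drop A = c >])%N.
Proof.
rewrite /drop_count -sum1_card -big_mkcondr /=.
by apply: eq_bigl => A; rewrite inE.
Qed.

Lemma drop_count0 c : (forall i, c i = 0%N) -> drop_count F 0 c = 1%N.
Proof.
move=> c0; rewrite /drop_count (@eq_card1 _ (0 : 'M[F]_0)) // => A.
rewrite !inE [A]flatmx0 eqxx; apply/andP; split.
  by apply/strictly_upperP=> -[].
apply/asboolP/funext=> i; rewrite c0 /rank_drop; apply/eqP.
by rewrite -leqn0 (leq_trans (leq_subr _ _)) // rank_leq_row.
Qed.

Lemma sum_strictly_upper n (f : 'M[F]_(1 + n) -> nat) :
  (\sum_(A | strictly_upper A) f A =
   \sum_(B : 'M[F]_n | strictly_upper B) \sum_(v : 'rV[F]_n) f (extend_mx v B))%N.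
Proof.
rewrite pair_big_dep /=.
rewrite (reindex_onto (fun p : 'M[F]_n * 'rV[F]_n => extend_mx p.2 p.1)
          (fun A => (drsubmx A, ursubmx A))) /=; last first.
  by move=> A /strictly_upper_extendP {3}->.
apply: eq_bigl => -[B v] /=; rewrite strictly_upper_extend andbT.
by rewrite /extend_mx block_mxKdr block_mxKur eqxx andbT.
Qed.

(** The matrices are sorted by the column of the box lost when their first row
    and column are removed; the remaining matrix has a prescribed type, and the
    number of possible first rows depends only on that type. *)
Lemma drop_count_rec n c L : (forall i, (L <= i)%N -> c i = 0%N) ->
  (drop_count F n.+1 c)%:R =
  \sum_(j < L | (0 < c j)%N) box_weight #|F|%:R n (remove_box c j) j *
    (drop_count F n (remove_box c j))%:R.
Proof.
move=> c0; rewrite drop_countE sum_strictly_upper.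
under eq_bigr => B suB do under eq_bigr => v _ do rewrite (adds_box_atE v suB c0).
under eq_bigr => B suB do rewrite exchange_big /=.
rewrite exchange_big natr_sum; apply: eq_bigr => j cj /=.
rewrite drop_countE !natr_sum mulr_sumr; apply: eq_bigr => B suB.
rewrite natr_sum; case: asboolP => [dropB|_] /=; last first.
  by rewrite mulr0 big1.
rewrite mulr1 -dropB -card_adds_box_at -sum1_card natr_sum [RHS]big_mkcond /=.
by apply: eq_bigr => v _; rewrite inE; case: adds_box_at.
Qed.

(** Drops are non-increasing; thus only the corners contribute to the
    recurrence. *)
Lemma drop_count_eq0 n c i : (c i < c i.+1)%N -> drop_count F n c = 0%N.
Proof.
move=> ci; apply: eq_card0 => A; rewrite !inE; apply/negP => /andP [_ /asboolP dA].
by have := rank_drop_anti A i; rewrite dA leqNgt ci.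
Qed.

End Recurrence.

(** * The recurrence for the reduced polynomial *)

(** The bound L on the number of columns is kept apart from n because removing
    boxes preserves it. *)
Record is_conj (L n : nat) (c : nat -> nat) : Prop := IsConj {
  conj_anti : forall i, (c i.+1 <= c i)%N;
  conj_eq0 : forall i, (L <= i)%N -> c i = 0%N;
  conj_sum : (\sum_(i < L) c i = n)%N }.

Lemma conj_le_sum L n c i : is_conj L n c -> (c i <= n)%N.
Proof.
move=> [_ c0 <-]; have [iL|Li] := ltnP i L; last by rewrite c0.
by rewrite (bigD1 (Ordinal iL)) //= leq_addr.
Qed.

Lemma conj_le_sum2 L n c i j : is_conj L n c -> i != j -> (c i + c j <= n)%N.
Proof.
move=> cc ij; have [jL|Lj] := ltnP j L; last first.
  by rewrite (conj_eq0 cc Lj) addn0; apply: conj_le_sum cc.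
have [iL|Li] := ltnP i L; last first.
  by rewrite (conj_eq0 cc Li); apply: conj_le_sum cc.
rewrite -(conj_sum cc) (bigD1 (Ordinal iL)) //= leq_add2l.
by rewrite (bigD1 (Ordinal jL)) ?leq_addr //= -val_eqE eq_sym.
Qed.

Lemma remove_box_neq c i j : i != j -> remove_box c j i = c i.
Proof. by rewrite /remove_box => /negbTE ->; rewrite subn0. Qed.

Lemma remove_box_eq c j : remove_box c j j = (c j).-1.
Proof. by rewrite /remove_box eqxx subn1. Qed.

Lemma conj_remove_box L n c j : is_conj L n.+1 c -> (c j.+1 < c j)%N ->
  is_conj L n (remove_box c j).
Proof.
move=> [ca c0 cs] cj; split=> [i|i Li|].
- rewrite /remove_box; have := ca i; case: (eqVneq i j) => [->|ij]; last by lia.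
  by move: cj; lia.
- by rewrite /remove_box c0.
- have jL : (j < L)%N by rewrite ltnNge; apply/negP => /c0 E; rewrite E in cj.
  rewrite (bigD1 (Ordinal jL)) //= remove_box_eq.
  move: cs; rewrite (bigD1 (Ordinal jL)) //=.
  rewrite [in X in _ -> X](eq_bigr (fun i : 'I_L => c i)); first by lia.
  by move=> i ij; rewrite remove_box_neq.
Qed.

(** The corner of the last nonempty column is the only one with an empty column
    to its right; it alone contributes to the value of [R_rec] at 0. *)
Lemma conj_last_corner L n c : is_conj L n.+1 c ->
  exists j : 'I_L, (c j.+1 < c j)%N /\
    forall i : 'I_L, (c i.+1 < c i)%N && (c i.+1 == 0%N) = (i == j).
Proof.
move=> cc; have ca := conj_anti cc.
have mono i k : (c (i + k) <= c i)%N.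
  by elim: k => [|k IH]; rewrite ?addn0 // addnS (leq_trans (ca _)).
have c0 : (0 < c 0%N)%N.
  rewrite lt0n; apply/negP => /eqP c00; have := conj_sum cc.
  by rewrite big1 // => i _; apply/eqP; rewrite -leqn0 -c00 (mono 0%N).
have ex : exists j, c j.+1 == 0%N.
  by exists L; rewrite (conj_eq0 cc).
case: (ex_minnP ex) => j /eqP cj jmin.
have cj0 : (0 < c j)%N.
  by case: j cj jmin => // j _ jmin; rewrite lt0n; apply/negP => /jmin; rewrite ltnn.
have jL : (j < L)%N by rewrite ltnNge; apply/negP => /(conj_eq0 cc) E; rewrite E in cj0.
exists (Ordinal jL); split; first by rewrite /= cj.
move=> i; apply/andP/eqP => [[ci /eqP ci0]|->]; last by rewrite /= cj.
apply/val_inj/eqP; rewrite /= eqn_leq jmin ?ci0 // andbT leqNgt; apply/negP => ji.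
by have := mono j.+1 (i - j.+1)%N; rewrite subnKC // cj; move: ci; lia.
Qed.

Definition qnum (m : nat) : {poly int} := \sum_(i < m) 'X^i.

Lemma mul_qnum m : (1 - 'X) * qnum m = 1 - 'X^m.
Proof. by rewrite -opprB mulNr -subrX1 opprB. Qed.

Definition R_weight (c : nat -> nat) (j : nat) : {poly int} :=
  'X^(c j.+1) * (if j is j'.+1 then qnum (c j' - c j).+1 else 1).

(** n is the number of boxes of c; it also makes the recursion structural. *)
Fixpoint R_rec (L n : nat) (c : nat -> nat) : {poly int} :=
  if n is n'.+1 then
    \sum_(j < L | (c j.+1 < c j)%N) R_weight c j * R_rec L n' (remove_box c j)
  else 1.

Lemma R_weight_horner0 c j : (R_weight c j).[0] = (c j.+1 == 0%N)%:R.
Proof.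
rewrite /R_weight hornerM hornerXn expr0n; case: j => [|j]; rewrite ?hornerC ?mulr1 //.
by rewrite /qnum big_ord_recl hornerD hornerXn horner_sum big1 ?addr0 ?mulr1 // => i _;
   rewrite hornerXn expr0n.
Qed.

Lemma R_rec_horner0 L n c : is_conj L n c -> (R_rec L n c).[0] = 1.
Proof.
elim: n c => [|n IH] c cc /=; first by rewrite hornerC.
have [j [cj jE]] := conj_last_corner cc.
rewrite horner_sum (bigD1 j) //= big1 ?addr0 => [|i /andP [ci ij]].
  rewrite hornerM R_weight_horner0 IH ?mulr1; last exact: conj_remove_box cc cj.
  by have := jE j; rewrite eqxx cj /= => ->.
rewrite hornerM R_weight_horner0; have := jE i; rewrite ci (negbTE ij) /= => ->.
by rewrite mul0r.
Qed.

Lemma R_rec_horner1 L n c : is_conj L n c -> 1 <= (R_rec L n c).[1].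
Proof.
have w1 k j : 1 <= (R_weight k j).[1].
  rewrite /R_weight hornerM hornerXn expr1n mul1r; case: j => [|j]; rewrite ?hornerC //.
  rewrite /qnum big_ord_recl hornerD hornerXn expr1n lerDl horner_sum.
  by apply: sumr_ge0 => i _; rewrite hornerXn expr1n.
elim: n c => [|n IH] c cc /=; first by rewrite hornerC.
have [j [cj _]] := conj_last_corner cc.
rewrite horner_sum (bigD1 j) //= hornerM.
apply: ler_wpDr; last by rewrite mulr_ege1 // IH //; apply: conj_remove_box cc cj.
apply: sumr_ge0 => i /andP [ci _]; rewrite hornerM mulr_ge0 //.
  exact: le_trans (w1 _ _).
by apply: le_trans (IH _ (conj_remove_box cc ci)).
Qed.

(** The exponent of q in P is binomial(n, 2) minus this number: 'C(c_0, 2) counts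
    the pairs of boxes in the first column, the sum those in adjacent columns. *)
Definition shape_exp (L : nat) (c : nat -> nat) : nat :=
  ('C(c 0, 2) + \sum_(i < L) c i * c i.+1)%N.

Lemma shape_exp_remove L c j : (j < L)%N -> (0 < c j)%N ->
  shape_exp L c = (shape_exp L (remove_box c j) +
    (if j is j'.+1 then c j' else (c 0).-1) + c j.+1)%N.
Proof.
move=> jL cj; set b := remove_box c j.
have cE i : c i = (b i + (i == j))%N.
  by rewrite /b /remove_box subnK //; case: eqP => // ->.
have delta (f : nat -> nat) k : (\sum_(i < L) f i * (i == k :> nat) = (k < L) * f k)%N.
  have [kL|Lk] := ltnP k L.
    rewrite (bigD1 (Ordinal kL)) //= eqxx big1 ?addn0 ?muln1 ?mul1n // => i.
    by rewrite -val_eqE /= => /negbTE ->; rewrite muln0.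
  by rewrite big1 // => i _; rewrite ltn_eqF ?muln0 // (leq_trans (ltn_ord i)).
have sumE : (\sum_(i < L) c i * c i.+1 = \sum_(i < L) b i * b i.+1 +
     \sum_(i < L) b i.+1 * (i == j :> nat) + \sum_(i < L) b i * (i.+1 == j))%N.
  rewrite -!big_split; apply: eq_bigr => i _ /=; rewrite !cE.
  by case: eqP => [->|_]; case: eqP => //=; lia.
rewrite /shape_exp sumE (delta (fun i => b i.+1)) jL mul1n.
rewrite (cE j.+1) (gtn_eqF (ltnSn j)) addn0.
case: j => [|j] in jL cj b cE sumE *.
  have -> : (\sum_(i < L) b i * (i.+1 == 0) = 0)%N.
    by rewrite big1 // => i _; rewrite muln0.
  by rewrite (cE 0%N) eqxx addn1 binS bin1 /=; lia.
have -> : (\sum_(i < L) b i * (i.+1 == j.+1) = \sum_(i < L) b i * (i == j :> nat))%N.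
  by apply: eq_bigr => i _; rewrite eqSS.
rewrite (delta b) ltnW // mul1n (cE 0%N) (cE j) (ltn_eqF (ltnSn j)) !addn0.
by lia.
Qed.

Lemma shape_exp_le L n c : is_conj L n c -> (shape_exp L c <= 'C(n, 2))%N.
Proof.
elim: n c => [|n IH] c cc.
  have c0 i : c i = 0%N by apply/eqP; rewrite -leqn0; apply: conj_le_sum cc.
  by rewrite /shape_exp c0 big1 // => i _; rewrite c0.
have [j [cj _]] := conj_last_corner cc; have bb := conj_remove_box cc cj.
rewrite (shape_exp_remove (ltn_ord j)) ?(leq_ltn_trans _ cj) //.
rewrite binS bin1 -addnA leq_add ?IH //.
case: j => [[|j] jL] /= in cj bb *.
  by have := conj_le_sum2 bb (erefl : 0%N != 1%N); rewrite remove_box_eq remove_box_neq.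
have := conj_le_sum2 bb (_ : j != j.+2).
by rewrite !remove_box_neq; [apply | | ..]; lia.
Qed.

(** * The counting polynomial and its reduced part *)

(** The power of q in P is written on the left, with [shape_exp], to avoid the
    subtraction of exponents in the induction. *)
Lemma drop_count_formula (F : finFieldType) L n c : is_conj L n c ->
  #|F|%:R ^+ shape_exp L c * (drop_count F n c)%:R =
  #|F|%:R ^+ 'C(n, 2) * (#|F|%:R - 1) ^+ (n - c 0%N) * (R_rec L n c).[#|F|%:R] :> int.
Proof.
set q : int := #|F|%:R.
elim: n c => [|n IH] c cc.
  have c0 i : c i = 0%N by apply/eqP; rewrite -leqn0; apply: conj_le_sum cc.
  rewrite drop_count0 // /shape_exp c0 big1 => [|i _]; last by rewrite c0.
  by rewrite /= hornerC !expr0.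
rewrite (drop_count_rec F n (conj_eq0 cc)) -/q /= horner_sum !mulr_sumr.
rewrite big_mkcond [RHS]big_mkcond; apply: eq_bigr => j _.
case: (ltnP (c j.+1) (c j)) => cj; last first.
  have [//|cj0] := posnP (c j).
  rewrite (@drop_count_eq0 F n _ j) ?mulr0 //.
  by rewrite remove_box_eq remove_box_neq ?gtn_eqF // prednK.
rewrite (leq_ltn_trans _ cj) //; set b := remove_box c j.
have bb : is_conj L n b by apply: conj_remove_box.
have cj0 : (0 < c j)%N by apply: leq_ltn_trans cj.
have {}IH := IH _ bb.
rewrite (shape_exp_remove (ltn_ord j) cj0) -/b hornerM.
have -> : q ^+ 'C(n.+1, 2) * (q - 1) ^+ (n.+1 - c 0%N) *
    ((R_weight c j).[q] * (R_rec L n b).[q]) =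
  q ^+ n * (q - 1) ^+ (n.+1 - c 0%N - (n - b 0%N)) * (R_weight c j).[q] *
    (q ^+ 'C(n, 2) * (q - 1) ^+ (n - b 0%N) * (R_rec L n b).[q]).
  have {1}-> : (n.+1 - c 0 = (n.+1 - c 0 - (n - b 0)) + (n - b 0))%N.
    rewrite subnK // /b /remove_box; have := conj_le_sum 0 bb.
    by rewrite /b /remove_box; lia.
  by rewrite binS bin1 !exprD; ring.
rewrite -IH /R_weight hornerM hornerXn /box_weight !exprD.
case: j => [[|j] jL] /= in cj cj0 b bb IH *.
  have b0 : b 0%N = (c 0%N).-1 by rewrite /b remove_box_eq.
  have -> : (n.+1 - c 0 - (n - b 0) = 0)%N by lia.
  have c0n := conj_le_sum 0 bb.
  have -> : q ^+ n = q ^+ (c 0%N).-1 * q ^+ (n - b 0%N) :> int.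
    by rewrite -exprD b0 subnKC // -b0.
  by rewrite hornerC subr0 expr0; ring.
have bj1 : b j = c j by rewrite /b remove_box_neq ?ltn_eqF.
have bj : b j.+1 = (c j.+1).-1 by rewrite /b remove_box_eq.
have b0 : b 0%N = c 0%N by rewrite /b remove_box_neq.
have c0n := conj_le_sum 0 bb; have cjn := conj_le_sum j bb.
have cjj := conj_anti cc j.
have -> : (n.+1 - c 0 - (n - b 0) = 1)%N by lia.
have -> : (n - b j.+1 = (n - c j) + (c j - c j.+1).+1)%N.
  by clear -bj cjn bj1 cj0 cjj; lia.
have -> : q ^+ n = q ^+ c j * q ^+ (n - c j) :> int.
  by rewrite -exprD subnKC // -bj1.
have -> : (qnum (c j - c j.+1).+1).[q] = \sum_(i < (c j - c j.+1).+1) q ^+ i.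
  by rewrite horner_sum; apply: eq_bigr => i _; rewrite hornerXn.
rewrite bj1 exprD expr1 -[X in _ - X]mulr1 -mulrBr subrX1.
ring.
Qed.

Lemma counts_R_rec L lam (n := psize lam) (c := conj_part lam) :
    sorted geq lam -> 0%N \notin lam -> is_conj L n c ->
  counts lam
    ('X^('C(n, 2) - shape_exp L c) * ('X - 1) ^+ (n - c 0%N) * R_rec L n c).
Proof.
move=> lam_sorted lam0 cc F; rewrite P_countE // -/n -/c.
have q0 : #|F|%:R ^+ shape_exp L c != 0 :> int.
  by rewrite expf_neq0 // pnatr_eq0 -lt0n; apply/card_gt0P; exists 0.
apply: (mulfI q0); rewrite (drop_count_formula F cc) !hornerM hornerXn horner_exp.
rewrite hornerD hornerX hornerN hornerC.
by rewrite -{2}(subnKC (shape_exp_le cc)) exprD !mulrA.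
Qed.

Lemma R_polyE L lam : sorted geq lam -> 0%N \notin lam ->
    is_conj L (psize lam) (conj_part lam) ->
  R_poly lam = R_rec L (psize lam) (conj_part lam).
Proof.
move=> lam_sorted lam0 cc; have cR := counts_R_rec lam_sorted lam0 cc.
have Rred : is_reduced_part (P_poly lam) (R_rec L (psize lam) (conj_part lam)).
  exists ('C(psize lam, 2) - shape_exp L (conj_part lam))%N.
  exists (psize lam - conj_part lam 0)%N; split.
  - by apply: xget_unique => [//|p cp]; apply: counts_unique cp cR.
  - by rewrite (R_rec_horner0 cc) oner_neq0.
  - by have := R_rec_horner1 cc; apply: contraTneq => ->; rewrite ler10.
by apply: xget_unique => [//|r rr]; apply: reduced_part_unique rr Rred.
Qed.


(** * Congruences modulo a power of X *)

Definition eqmodX (m : nat) (p r : {poly int}) : Prop :=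
  exists u, p = r + 'X^m * u.

Lemma eqmodX_refl m p : eqmodX m p p.
Proof. by exists 0; rewrite mulr0 addr0. Qed.

Lemma eqmodX_leq m m' p r : (m' <= m)%N -> eqmodX m p r -> eqmodX m' p r.
Proof.
move=> /subnK <- [u ->]; exists ('X^(m - m') * u).
by rewrite mulrA -exprD addnC.
Qed.

Lemma eqmodX_mul m p p' r r' : eqmodX m p r -> eqmodX m p' r' ->
  eqmodX m (p * p') (r * r').
Proof.
by move=> [u ->] [u' ->]; exists (r * u' + u * r' + 'X^m * u * u'); ring.
Qed.

Lemma eqmodX_mulXn m k p r : eqmodX m p r -> eqmodX (k + m) ('X^k * p) ('X^k * r).
Proof. by move=> [u ->]; exists u; rewrite mulrDr exprD mulrA. Qed.

Lemma eqmodX_sum m k (f g : 'I_k -> {poly int}) :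
  (forall i, eqmodX m (f i) (g i)) -> eqmodX m (\sum_i f i) (\sum_i g i).
Proof.
move=> fg; apply: (big_ind2 (eqmodX m)) => [|a b a' b' [u ->] [v ->]|i _].
- exact: eqmodX_refl.
- by exists (u + v); ring.
- exact: fg.
Qed.

Lemma eqmodX_sub1Xn m k : (m <= k)%N -> eqmodX m (1 - 'X^k) 1.
Proof. by move=> /subnKC <-; exists (- 'X^(k - m)); rewrite exprD mulrN. Qed.

(** * The denominator of the limit *)

Lemma S_polyS k : S_poly k.+1 = S_poly k * (1 - 'X^(k.+1)).
Proof. by rewrite /S_poly big_nat_recr. Qed.

Lemma S_poly0 : S_poly 0 = 1.
Proof. by rewrite /S_poly big_geq. Qed.

Definition S_prod (L : nat) (c : nat -> nat) : {poly int} :=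
  \prod_(1 <= i < L) S_poly (c i - c i.+1).

Definition R_denom (L n : nat) (c : nat -> nat) : {poly int} :=
  (1 - 'X) ^+ (n - c 0%N) * S_prod L c.

(** Removing a box from column j replaces a part j+1 by a part j, so that it
    changes two multiplicities; that of the part 1, for j = 1, does not occur in
    the product. *)
Lemma S_prod_remove L n c j : is_conj L n c -> (0 < j)%N -> (c j.+1 < c j)%N ->
  S_prod L c * (if (1 < j)%N then 1 - 'X^((c j.-1 - c j).+1) else 1) =
  S_prod L (remove_box c j) * (1 - 'X^(c j - c j.+1)).
Proof.
move=> cc j0 cj; set b := remove_box c j.
have jL : (j < L)%N by rewrite ltnNge; apply/negP => /(conj_eq0 cc) E; rewrite E in cj.
have del k (x : {poly int}) : \prod_(1 <= i < L) (if i == k then x else 1) =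
    if (1 <= k < L)%N then x else 1.
  by rewrite -big_mkcond big_nat1_eq.
have <- : \prod_(1 <= i < L) (if i == j then 1 - 'X^(c j - c j.+1) else 1) =
    1 - 'X^(c j - c j.+1) :> {poly int} by rewrite del j0 jL.
have <- : \prod_(1 <= i < L) (if i == j.-1 then 1 - 'X^((c j.-1 - c j).+1) else 1) =
    if (1 < j)%N then 1 - 'X^((c j.-1 - c j).+1) else 1 :> {poly int}.
  by rewrite del; congr (if _ then _ else _); clear -j0 jL; lia.
rewrite /S_prod -!big_split /=; apply: eq_bigr => i _.
case: (eqVneq i j) => [->|ij].
  rewrite gtn_eqF ?prednK // mulr1 /b remove_box_eq remove_box_neq ?gtn_eqF //.
  have -> : (c j - c j.+1 = ((c j).-1 - c j.+1).+1)%N by clear -cj; lia.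
  exact: S_polyS.
rewrite mulr1 /b (remove_box_neq _ ij).
case: (eqVneq i j.-1) => [ij1|ij1].
  rewrite ij1 prednK // remove_box_eq -S_polyS; congr S_poly.
  by have := conj_anti cc j.-1; rewrite prednK //; clear -cj; lia.
by rewrite mulr1 remove_box_neq //; apply: contraNneq ij1 => <-.
Qed.

Lemma conj_ones L n c : is_conj L n c -> c 1%N = 0%N ->
  (forall i, (0 < i)%N -> c i = 0%N) /\ c 0%N = n.
Proof.
move=> cc c1; have c0 i : (0 < i)%N -> c i = 0%N.
  case: i => // i _; elim: i => // i IHi.
  by apply/eqP; rewrite -leqn0 -IHi; apply: conj_anti cc _.
split=> //; rewrite -(conj_sum cc).
case: L cc => [|L] cc; first by rewrite big_ord0 (conj_eq0 cc).
by rewrite big_ord_recl big1 ?addn0 // => i _; rewrite c0.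
Qed.

Lemma R_rec_ones L n c : is_conj L n c -> c 1%N = 0%N -> R_rec L n c = 1.
Proof.
elim: n c => [//|n IH] c cc c1 /=.
have [c0 _] := conj_ones cc c1.
have [j [cj jE]] := conj_last_corner cc.
have j0 : j = 0%N :> nat by case: (posnP j) cj => // /c0 ->.
rewrite (bigD1 j) //= big1 ?addr0 => [|i /andP [ci ij]]; last first.
  by have := jE i; rewrite ci c0 // (negbTE ij).
rewrite /R_weight IH; last by rewrite remove_box_neq ?j0.
  by rewrite j0 c1 expr0 !mulr1.
exact: conj_remove_box.
Qed.

Lemma R_denom_ones L n c : is_conj L n c -> c 1%N = 0%N -> R_denom L n c = 1.
Proof.
move=> cc c1; have [c0 cn] := conj_ones cc c1.
rewrite /R_denom cn subnn expr0 mul1r /S_prod big_nat big1 // => i /andP [i0 _].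
by rewrite !c0 // S_poly0.
Qed.

(** Multiplying the recurrence of [R_rec] by [R_denom] turns the j-th term into
    X^c_(j+1) - X^c_j and the first one into X^c_1, modulo X^(k+1) with k the
    number of parts equal to 1; these terms telescope to 1.  In the first term
    the induction hypothesis only holds modulo X^k, and the factor X^c_1, where
    c_1 > 0, makes up for the loss. *)
Lemma R_denom_mul_R_rec L n c : is_conj L n c ->
  eqmodX (c 0%N - c 1%N).+1 (R_denom L n c * R_rec L n c) 1.
Proof.
elim: n c => [|n IH] c cc.
  have c1 : c 1%N = 0%N by apply/eqP; rewrite -leqn0; apply: conj_le_sum cc.
  by rewrite R_denom_ones // mul1r; apply: eqmodX_refl.
have [c1|c1] := posnP (c 1%N).
  by rewrite R_denom_ones ?R_rec_ones // mul1r; apply: eqmodX_refl.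
have c01 := conj_anti cc 0.
set k := (c 0%N - c 1%N)%N.
have L0 : (0 < L)%N.
  rewrite lt0n; apply/negP => /eqP L0; move: c1.
  by rewrite (conj_eq0 cc) // L0.
rewrite /= mulr_sumr big_mkcond /=.
pose t (j : nat) : {poly int} :=
  if j is 0 then 'X^(c 1%N) else 'X^(c j.+1) - 'X^(c j).
have tsum M : \sum_(j < M.+1) t j = 'X^(c M.+1).
  elim: M => [|M IHM]; first by rewrite big_ord_recl big_ord0 addr0.
  by rewrite big_ord_recr IHM /= addrC subrK.
have -> : 1 = \sum_(j < L) t j.
  by rewrite -(prednK L0) tsum prednK // (conj_eq0 cc).
apply: eqmodX_sum => -[j jL] /=.
case: ltnP => cj; last first.
  have {cj} cj : c j.+1 = c j by apply/eqP; rewrite eqn_leq cj (conj_anti cc).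
  case: j jL cj => [|j] jL cj /=; last by rewrite cj subrr; apply: eqmodX_refl.
  by rewrite /k cj subnn; exists (- 'X^((c 0%N).-1));
     rewrite mulrN -exprD add1n prednK ?subrr // -cj.
set b := remove_box c j; have bb : is_conj L n b by apply: conj_remove_box.
have {}IH := IH b bb.
have cj0 : (0 < c j)%N by apply: leq_ltn_trans cj.
have c0n := conj_le_sum 0 bb.
rewrite /R_weight; case: j => [|j] /= in jL cj b bb IH cj0 c0n *.
  have b0 : b 0%N = (c 0%N).-1 by rewrite /b remove_box_eq.
  have b1 : b 1%N = c 1%N by rewrite /b remove_box_neq.
  have -> : R_denom L n.+1 c = R_denom L n b.
    rewrite /R_denom; congr (_ ^+ _ * _); first by rewrite b0; clear -cj0; lia.
    rewrite /S_prod !big_nat; apply: eq_bigr => i /andP [i0 _].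
    by rewrite /b !remove_box_neq ?gtn_eqF.
  rewrite mulr1 mulrCA -['X^(c 1%N)]mulr1 -mulrA mul1r.
  apply: (@eqmodX_leq (c 1%N + k)); first by rewrite -add1n leq_add2r.
  apply: eqmodX_mulXn; apply: eqmodX_leq IH.
  by rewrite b0 b1 /k; clear -cj; lia.
have b0 : b 0%N = c 0%N by rewrite /b remove_box_neq.
pose y : {poly int} := 1 - 'X^(c j.+1 - c j.+2).
(* When a box leaves column 1, here for j = 0, the q-number comes from the k
   parts equal to 1, whose multiplicity does not enter the denominator. *)
pose z : {poly int} := if (0 < j)%N then 1 else 1 - 'X^(k.+1).
have key : R_denom L n.+1 c * qnum (c j - c j.+1).+1 = R_denom L n b * y * z.
  rewrite /R_denom b0 subSn; last by rewrite -b0.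
  rewrite exprSr -!mulrA [_ * (S_prod _ _ * _)]mulrCA mul_qnum.
  congr (_ * _); have := S_prod_remove cc (ltn0Sn j) cj; rewrite /= -/b -/y /z.
  rewrite mulrA => <-; rewrite ltnS; case: posnP => [->|_] /=.
    by rewrite mulr1 -/k.
  by rewrite mulr1.
have -> : R_denom L n.+1 c * ('X^(c j.+2) * qnum (c j - c j.+1).+1 * R_rec L n b) =
    'X^(c j.+2) * y * (z * (R_denom L n b * R_rec L n b)).
  rewrite [RHS](_ : _ = 'X^(c j.+2) * (R_denom L n b * y * z) * R_rec L n b).
    by rewrite -key; ring.
  by ring.
have -> : 'X^(c j.+2) - 'X^(c j.+1) = 'X^(c j.+2) * y * (1 * 1).
  by rewrite !mulr1 /y mulrBr mulr1 -exprD subnKC // ltnW.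
apply: eqmodX_mul; first exact: eqmodX_refl.
apply: eqmodX_mul.
  by rewrite /z; case: ifP => _; [apply: eqmodX_refl|apply: eqmodX_sub1Xn].
apply: eqmodX_leq IH; rewrite ltnS b0 /k leq_sub2l //.
by rewrite /b /remove_box leq_subr.
Qed.

(** * The limit as a power series *)

(** The truncated geometric sum defining [series_inv] inverts D modulo X^(m+1),
    hence agrees with any other inverse up to that order. *)
Lemma series_inv_coef (D p : {poly int}) m : D`_0 = 1 -> eqmodX m.+1 (D * p) 1 ->
  p`_m = series_inv D m.
Proof.
move=> D0 [v Dp]; rewrite /series_inv.
have [w uw] : exists w, 1 - D = w * 'X.
  have : root (1 - D) 0 by rewrite /root horner_coef0 coefB coef1 D0 subrr.
  by move=> /factor_theorem [w ->]; exists w; rewrite subr0.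
set G := \sum_(j < m.+1) (1 - D) ^+ j.
have GD : G * D = 1 - w ^+ m.+1 * 'X^(m.+1).
  by rewrite -exprMn -uw -[RHS]opprB subrX1 -/G; ring.
have -> : p = G + 'X^(m.+1) * (G * v + w ^+ m.+1 * p).
  have : G * (D * p) = G * (1 + 'X^(m.+1) * v) by rewrite Dp.
  rewrite mulrA GD => E.
  transitivity ((1 - w ^+ m.+1 * 'X^(m.+1)) * p + 'X^(m.+1) * (w ^+ m.+1 * p)).
    by ring.
  by rewrite E; ring.
by rewrite coefD coefXnM ltnSn addr0.
Qed.

Lemma S_poly_coef0 k : (S_poly k)`_0 = 1.
Proof.
elim: k => [|k IH]; first by rewrite S_poly0 coef1.
by rewrite S_polyS -horner_coef0 hornerM !horner_coef0 IH coefB coef1 coefXn subr0 mulr1.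
Qed.

Lemma conj_part_is_conj L lam : all (geq L) lam ->
  is_conj L (psize lam) (conj_part lam).
Proof.
move=> lamL; split=> [i|i Li|].
- by apply: sub_count => x /=; apply: ltnW.
- apply/eqP; rewrite eqn0Ngt -has_count -all_predC; apply: sub_all lamL => x /= xL.
  by rewrite -leqNgt (leq_trans xL).
- rewrite psizeE; elim: lam lamL => [|x lam IH] /= => [_|/andP [xL lamL]].
    by rewrite big1.
  rewrite -IH // [LHS]big_split /=; congr (_ + _)%N.
  transitivity (\sum_(i < x) 1)%N; last by rewrite sum1_card card_ord.
  by rewrite (big_ord_widen _ (fun=> 1%N) xL) [RHS]big_mkcond;
    apply: eq_bigr => i _; case: ltnP.
Qed.

Lemma conj_part_count lam k : 
  count_mem k.+1 lam = (conj_part lam k - conj_part lam k.+1)%N.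
Proof.
suff -> : conj_part lam k = (count_mem k.+1 lam + conj_part lam k.+1)%N by rewrite addnK.
elim: lam => //= x lam; rewrite /conj_part /= => ->; clear.
by case: eqP => [->|]; case: ltnP; case: ltnP; lia.
Qed.

Theorem theorem6p2 (n : nat) (lam : seq nat)
    (n_gt0 : (0 < n)%N) (lam_part : is_partition n lam)
    (no_one : 1%N \notin lam) :
  is_R_infty lam
    (series_inv
       ((1 - 'X) ^+ (n - size lam) *
        \prod_(2 <= k < (largest_part lam).+1) S_poly (count_mem k lam))).
Proof.
move: lam_part => /and3P [lam_sorted lam0 /eqP sum_lam] m.
exists m => k mk; set mu := add_ones lam k; set L := largest_part lam.
have lam_le : all (geq L) lam.
  rewrite /L; case: lam lam_sorted {lam0 sum_lam no_one mu L} => //= x lam pl.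
  rewrite leqnn; apply: order_path_min pl => a b c /= ba cb; exact: leq_trans cb ba.
have L0 : (0 < L)%N.
  rewrite /L; case: lam lam0 sum_lam {lam_sorted no_one lam_le mu L} => [|x lam] /=.
    by move=> _ n0; rewrite -n0 in n_gt0.
  by rewrite inE negb_or eq_sym -lt0n => /andP [].
have mu_sorted : sorted geq mu.
  have gtr : transitive geq by move=> a b c /= ba cb; apply: leq_trans cb ba.
  rewrite (sorted_pairwise gtr) pairwise_cat -!(sorted_pairwise gtr) lam_sorted /=.
  apply/andP; split.
    apply/allrelP => x y xl /nseqP [-> _] /=; rewrite lt0n.
    by apply: contraNneq lam0 => <-.
  by elim: (k) => // -[|j] //= ->.
have mu0 : 0%N \notin mu by rewrite mem_cat negb_or lam0; apply/negP => /nseqP [].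
have mu_conj : is_conj L (psize mu) (conj_part mu).
  apply: conj_part_is_conj; rewrite all_cat lam_le /=.
  by apply/allP => x /nseqP [-> _].
have cE i : conj_part mu i = (conj_part lam i + (i == 0) * k)%N.
  by rewrite /conj_part count_cat count_nseq; case: i => [|[]].
have c0 : conj_part lam 0 = size lam.
  apply/eqP; rewrite -all_count; apply/allP => x xl; rewrite /= lt0n.
  by apply: contraNneq lam0 => <-.
have c1 : conj_part lam 1 = size lam.
  have := conj_part_count lam 0; rewrite (count_memPn no_one) c0 => /esym/eqP.
  rewrite subn_eq0 => le; apply/eqP; rewrite eqn_leq le andbT.
  exact: count_size.
have denomE : (1 - 'X) ^+ (n - size lam) *
    \prod_(2 <= k < L.+1) S_poly (count_mem k lam) =
    R_denom L (psize mu) (conj_part mu).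
  rewrite /R_denom psizeE sumn_cat sum_lam sumn_nseq mul1n cE c0 mul1n subnDr.
  congr (_ * _); rewrite big_add1 /S_prod !big_nat; apply: eq_bigr => i /andP [i0 _].
  by rewrite !cE gtn_eqF //= !addn0 conj_part_count.
rewrite denomE (R_polyE mu_sorted mu0 mu_conj); apply: series_inv_coef.
  rewrite /R_denom -horner_coef0 hornerM horner_exp hornerD hornerN hornerX hornerC.
  rewrite subr0 expr1n mul1r /S_prod horner_prod big1 // => i _.
  by rewrite horner_coef0 S_poly_coef0.
apply: eqmodX_leq (R_denom_mul_R_rec mu_conj); rewrite !cE c0 c1 /= mul1n mul0n addn0.
by rewrite ltnS addKn.
Qed.
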